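(* Let $n\ge r\ge 2$ be integers, let $p$ be a real number with $2>p\ge 1$, and let $A=[a_{i,j}]$ be an $n\times n$ complex matrix with $\|A\|_{\max}\le 1$. If $A$ is $r$-partite, then $$\|A\|_p\le n^{1/2+1/p}\sqrt{1-1/r}.$$ Equality holds if and only if all singular values of $A$ are equal to $\sqrt{(1-1/r)n}$.
   Context: $\|A\|_{\max}:=\max_{i,j}|a_{i,j}|$. For an $n\times n$ complex matrix $A$ with singular values $\sigma_1\ge\cdots\ge\sigma_n$ and real $p\ge1$, the Schatten $p$-norm is $\|A\|_p:=(\sigma_1^p+\cdots+\sigma_n^p)^{1/p}$. An $n\times n$ matrix $A$ is called $r$-partite if there is a partition $[n]=\{1,\dots,n\}=N_1\cup\cdots\cup N_r$ of its index set into $r$ nonempty sets such that for every $i\in\{1,\dots,r\}$ the submatrix $A[N_i,N_i]$ of all entries with both indices in $N_i$ is zero. *)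

(* Defs.v *)
From mathcomp Require Import all_boot all_order all_algebra.
From mathcomp Require Import complex.
From mathcomp Require Import reals exp.

Set Implicit Arguments.
Unset Strict Implicit.
Unset Printing Implicit Defensive.

Import Order.TTheory GRing.Theory Num.Theory.
Local Open Scope ring_scope.
Local Open Scope sesquilinear_scope.
Local Open Scope complex_scope.

Definition max_norm (R : realType) (n : nat) (A : 'M[R[i]]_n) : R :=
  \big[Num.max/0]_(i < n) \big[Num.max/0]_(j < n) ComplexField.Normc.normc (A i j).

(* [spectral_diag] lists the eigenvalues of the normal matrix A^* A, with
   multiplicity but in an unspecified order, hence the sorting (decreasing);
   [char_poly_singular_values] below pins down the multiset of values. *)
Definition singular_values (R : realType) (n : nat) (A : 'M[R[i]]_n) : n.-tuple R :=
  [tuple of sort >=%R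
     [tuple Num.sqrt (complex.Re (spectral_diag (A^t* *m A) 0 i)) | i < n]].

Lemma char_poly_singular_values (R : realType) (n : nat) (A : 'M[R[i]]_n) :
  char_poly (A^t* *m A) =
  \prod_(s <- singular_values A) ('X - ((s ^+ 2)%:C)%:P).
Proof.
set B := A^t* *m A; set U := spectralmx B; set d := spectral_diag B.
have BN : B \is normalmx.
  apply/normalmxP; have -> // : B^t* = B.
  by rewrite /B trmx_mul map_mxM -/(A^t*^t*) trmxCK.
have BE : B = invmx U *m diag_mx d *m U := orthomx_spectralP BN.
have Uu : U \is unitarymx := spectral_unitarymx B.
have Uunit : U \in unitmx := spectral_unit B.
have d_ge0 i : 0 <= d 0 i.
  have -> : d 0 i = (U *m A^t* *m (U *m A^t*)^t*) i i.
    rewrite trmx_mul map_mxM -/(A^t*^t*) trmxCK mulmxA -(mulmxA U) -/B BE.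
    rewrite !mulmxA mulmxV // mul1mx -mulmxA (unitarymxP Uu) mulmx1.
    by rewrite mxE eqxx mulr1n.
  rewrite mxE; apply: sumr_ge0 => j _; rewrite !mxE; exact: mul_conjC_ge0.
have -> : char_poly B = char_poly (diag_mx d).
  have UB : U *m B = diag_mx d *m U.
    by rewrite [in LHS]BE !mulmxA mulmxV // mul1mx.
  have dU : \det (map_mx polyC U) != 0.
    by rewrite det_map_mx polyC_eq0 -unitfE -unitmxE.
  apply: (mulfI dU); rewrite [RHS]mulrC -!det_mulmx /char_poly_mx.
  by rewrite mulmxBr mulmxBl -!map_mxM UB scalar_mxC.
rewrite char_poly_trig ?diag_mx_is_trig //.
rewrite (perm_big [tuple Num.sqrt (complex.Re (d 0 i)) | i < n]) /=; last first.
  by rewrite perm_sort.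
rewrite big_map big_enum /=; apply: eq_bigr => i _.
rewrite mxE eqxx mulr1n; congr ('X - _%:P).
have := d_ge0 i; case: (d 0 i) => a b; rewrite lecE /= => /andP[/eqP -> a0].
by rewrite sqr_sqrtr.
Qed.

Definition schatten_norm (R : realType) (n : nat) (p : R) (A : 'M[R[i]]_n) : R :=
  (\sum_(i < n) tnth (singular_values A) i `^ p) `^ p^-1.

Definition rpartite (R : realType) (n r : nat) (A : 'M[R[i]]_n) : Prop :=
  exists P : {set {set 'I_n}},
    [/\ partition P [set: 'I_n], #|P| = r
      & forall N : {set 'I_n}, N \in P ->
          forall i j : 'I_n, i \in N -> j \in N -> A i j = 0].

(* Main.v *)
Require Import Defs.
From mathcomp Require Import all_boot all_order all_algebra.
From mathcomp Require Import complex.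
From mathcomp Require Import reals exp.
From mathcomp Require Import ring lra.

Set Implicit Arguments.
Unset Strict Implicit.
Unset Printing Implicit Defensive.

Import Order.TTheory GRing.Theory Num.Theory.
Local Open Scope ring_scope.

(** The argument compares the Schatten [p]-norm with the Frobenius norm.

    The squares of the singular values add up to the trace of A^* A, that is to
    the sum of the squared moduli of the entries ([sum_sqr_singular_values]).
    Each entry has modulus at most 1 and the entries inside the diagonal blocks
    N_i x N_i vanish, so this sum is at most n^2 - sum_i |N_i|^2.  By
    Cauchy-Schwarz the [r] block sizes satisfy sum_i |N_i|^2 >= n^2 / r
    ([sum_sqr_card_partition]); hence the mean square of the singular values is
    at most d^2 = (1 - 1/r) n ([rpartite_sum_sqr_le]).

    Since [p < 2], the power mean inequality then bounds the mean of their
    [p]-th powers by d^p ([sum_powR_le]).  Taking [p]-th roots of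
    sum_i s_i^p <= n d^p gives the claim, because
    n^(1/p) d = n^(1/2 + 1/p) sqrt (1 - 1/r).

    The equality case needs no separate study of the matrix: it comes from a
    power mean inequality with an explicit error term
    ([powR_le_parabola]), a positive multiple of sum_i (s_i / d - 1)^2.  Equality
    of the norms kills this term and so forces every singular value to be [d]. *)

(** Young's inequality for the product of [s `^ q] and [1], with conjugate
    exponents [q^-1] and [(1 - q)^-1]. *)
Lemma powR_le_chord (R : realType) (q s : R) :
  0 < q -> q < 1 -> 0 <= s -> s `^ q <= 1 + q * (s - 1).
Proof.
move=> q0 q1 s0; have q1' : 0 < 1 - q by rewrite subr_gt0.
have := @conjugate_powR R (s `^ q) 1 q^-1 (1 - q)^-1 (powR_ge0 _ _) ler01.
rewrite !invr_gt0 => /(_ q0 q1'); rewrite !invrK addrC subrK => /(_ erefl).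
rewrite mulr1 -powRrM mulfV ?gt_eqF// powRr1// powR1 mul1r.
by have -> : 1 + q * (s - 1) = s * q + (1 - q) by ring.
Qed.

(** The tangent line at 1 of the concave function u |-> u^(p/2), taken at
    u = s^2, with a quadratic gain that quantifies strict concavity.  The gain
    appears when the tangent inequality is applied to s^(p/2) and then squared:
    the right-hand side is exactly the square of 1 + p/2 (s - 1). *)
Lemma powR_le_parabola (R : realType) (p s : R) :
  0 < p -> p < 2 -> 0 <= s ->
  s `^ p <= 1 + p / 2 * (s ^+ 2 - 1) - p / 2 * (1 - p / 2) * (s - 1) ^+ 2.
Proof.
move=> p0 p2 s0; have hq0 : 0 < p / 2 by lra.
have hq1 : p / 2 < 1 by lra.
have le1 := powR_le_chord hq0 hq1 s0.
have -> : s `^ p = (s `^ (p / 2)) ^+ 2.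
  by rewrite -powR_mulrn ?powR_ge0// -powRrM divfK// pnatr_eq0.
have -> : 1 + p / 2 * (s ^+ 2 - 1) - p / 2 * (1 - p / 2) * (s - 1) ^+ 2
        = (1 + p / 2 * (s - 1)) ^+ 2 by field.
by rewrite ler_sqr ?nnegrE ?powR_ge0// (le_trans _ le1)// powR_ge0.
Qed.

(** Power mean inequality between the exponents [p < 2] and 2, with its equality
    case: summing [powR_le_parabola] over the ratios [s i / d], the linear terms
    add up to something nonpositive and only the deviation term remains. *)
Lemma sum_powR_le (R : realType) (I : finType) (p d : R) (s : I -> R) :
  0 < p -> p < 2 -> 0 < d -> (forall i, 0 <= s i) ->
  \sum_i s i ^+ 2 <= #|I|%:R * d ^+ 2 ->
  \sum_i s i `^ p <= #|I|%:R * d `^ p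
  /\ (\sum_i s i `^ p = #|I|%:R * d `^ p -> forall i, s i = d).
Proof.
move=> p0 p2 d0 s0 le2; pose t i := s i / d.
have t0 i : 0 <= t i by rewrite divr_ge0// ltW.
have sE i : s i = d * t i by rewrite mulrC divfK// gt_eqF.
pose k := p / 2 * (1 - p / 2); have k0 : 0 < k by apply: mulr_gt0; lra.
have cardE : \sum_(i : I) (1 : R) = #|I|%:R by rewrite sumr_const.
(* The hypothesis on the squares, divided by [d ^+ 2]. *)
have t2 : \sum_i (t i ^+ 2 - 1) <= 0.
  rewrite big_split/= sumrN cardE subr_le0 -(ler_pM2r (exprn_gt0 2 d0)).
  rewrite mulr_suml (le_trans _ le2)// ler_sum// => i _.
  by rewrite [in leRHS]sE (exprMn _ d) mulrC.
have sumpE : \sum_i s i `^ p = d `^ p * \sum_i t i `^ p.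
  by rewrite mulr_sumr; apply: eq_bigr => i _; rewrite sE powRM// ltW.
have lep : \sum_i t i `^ p <= #|I|%:R - k * \sum_i (t i - 1) ^+ 2.
  have le1 : \sum_i t i `^ p <=
      \sum_i (1 + p / 2 * (t i ^+ 2 - 1) - k * (t i - 1) ^+ 2).
    by apply: ler_sum => i _; exact: powR_le_parabola.
  rewrite (le_trans le1)// sumrB big_split/= cardE -!mulr_sumr.
  by rewrite lerD2r gerDl pmulr_rle0//; lra.
have dp0 : 0 < d `^ p by rewrite powR_gt0.
have dev_ge0 : 0 <= \sum_i (t i - 1) ^+ 2 by apply: sumr_ge0 => i _; exact: sqr_ge0.
rewrite sumpE [_ * d `^ p]mulrC; split.
  rewrite ler_pM2l// (le_trans lep)// gerBl.
  by apply: mulr_ge0 => //; exact: ltW.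
move=> /(mulfI (lt0r_neq0 dp0)) eqp i.
(* At equality [lep] says that [k], which is positive, times the deviation is
   at most 0. *)
have dev0 : \sum_i (t i - 1) ^+ 2 == 0.
  rewrite eq_le dev_ge0 andbT -(pmulr_rle0 _ k0).
  by move: lep; rewrite eqp; lra.
move: dev0; rewrite psumr_eq0 => [/allP/(_ i)|j _]; last exact: sqr_ge0.
rewrite mem_index_enum => /(_ isT) /=; rewrite sqrf_eq0 subr_eq0 => /eqP ti1.
by rewrite sE ti1 mulr1.
Qed.

(** Both sides are the trace of A^* A, read off on the left from the second
    leading coefficient of its characteristic polynomial. *)
Lemma sum_sqr_singular_values (R : realType) (n : nat) (A : 'M[R[i]]_n) :
  \sum_(i < n) tnth (singular_values A) i ^+ 2
  = \sum_(j < n) \sum_(i < n) ComplexField.Normc.normc (A i j) ^+ 2.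
Proof.
case: n A => [|n] A; first by rewrite !big_ord0.
apply: (@complexI R); rewrite !rmorph_sum/=.
have := char_poly_trace (map_mx Num.conj (A^T) *m A) (ltn0Sn n).
rewrite char_poly_singular_values.
rewrite -(big_map (fun s : R => (s ^+ 2)%:C%C) predT (fun z => 'X - z%:P)).
have szE : size [seq (s ^+ 2)%:C%C | s <- singular_values A] = n.+1.
  by rewrite size_map size_tuple.
rewrite -[X in _`_X.-1]szE coefPn_prod_XsubC ?szE// => /oppr_inj.
rewrite big_map big_tuple => ->; apply: eq_bigr => j _.
rewrite mxE rmorph_sum; apply: eq_bigr => i _.
by rewrite !mxE [LHS]mulrC -sqr_normc rmorphXn; case: (A i j).
Qed.

Lemma normc_le_max_norm (R : realType) (n : nat) (A : 'M[R[i]]_n) (i j : 'I_n) :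
  ComplexField.Normc.normc (A i j) <= max_norm A.
Proof.
rewrite /max_norm; apply: le_trans (le_bigmax _ _ i) => /=.
exact: (le_trans _ (le_bigmax _ _ j)).
Qed.

(** Cauchy-Schwarz, obtained by expanding the squared deviations of the block
    sizes from their mean #|T| / #|P|. *)
Lemma sum_sqr_card_partition (R : realType) (T : finType) (P : {set {set T}}) :
  partition P [set: T] -> P != set0 ->
  #|T|%:R ^+ 2 / #|P|%:R <= \sum_(N in P) #|N|%:R ^+ 2 :> R.
Proof.
move=> partP P0; set m := #|T|%:R; set r : R := #|P|%:R.
have r0 : 0 < r by rewrite ltr0n card_gt0.
have cardE : \sum_(N in P) #|N|%:R = m.
  by rewrite /m -cardsT (card_partition partP) natr_sum.
have : 0 <= \sum_(N in P) (#|N|%:R - m / r) ^+ 2.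
  by apply: sumr_ge0 => N _; exact: sqr_ge0.
have -> : \sum_(N in P) (#|N|%:R - m / r) ^+ 2
        = \sum_(N in P) #|N|%:R ^+ 2 - m ^+ 2 / r; last by rewrite subr_ge0.
under eq_bigr do rewrite sqrrB.
rewrite big_split sumrB /= sumr_const -/r -mulr_natr -/r.
rewrite sumrMnl -mulr_suml cardE.
by field; rewrite gt_eqF.
Qed.

(** In column [j] only the rows outside the block of [j] contribute, so the
    column weighs at most [n] minus the size of that block; summed over the
    columns, each block is counted as many times as it has elements. *)
Lemma rpartite_sum_sqr_le (R : realType) (n r : nat) (A : 'M[R[i]]_n) :
  (0 < r)%N -> max_norm A <= 1 -> rpartite r A ->
  \sum_(j < n) \sum_(i < n) ComplexField.Normc.normc (A i j) ^+ 2
  <= n%:R ^+ 2 * (1 - r%:R^-1).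
Proof.
move=> r0 hA [P [partP cardP zeroA]].
have [/eqP covP trivP _] := and3P partP.
have jcov j : j \in cover P by rewrite covP inE.
have P0 : P != set0 by rewrite -card_gt0 cardP.
have normA_le j : \sum_(i < n) ComplexField.Normc.normc (A i j) ^+ 2
    <= n%:R - #|pblock P j|%:R.
  rewrite (bigID [in pblock P j])/= big1 ?add0r => [|i ij]; last first.
    rewrite (zeroA (pblock P j)) ?pblock_mem ?mem_pblock ?jcov//.
    by rewrite ComplexField.Normc.normc0 expr0n.
  rewrite -natrB; last by rewrite -[leqRHS]card_ord max_card.
  have -> : (n - #|pblock P j|)%N = #|[predC pblock P j]|.
    by rewrite -[X in (X - _)%N]card_ord -(cardC [in pblock P j]) addKn.
  rewrite -sumr_const; apply: ler_sum => i _.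
  rewrite expr_le1 ?(le_trans (normc_le_max_norm _ _ _))//.
  by case: (A i j) => a b; exact: sqrtr_ge0.
have blockE : \sum_(j < n) #|pblock P j|%:R = \sum_(N in P) #|N|%:R ^+ 2 :> R.
  have -> : \sum_(j < n) #|pblock P j|%:R
      = \sum_(j in [set: 'I_n]) #|pblock P j|%:R :> R.
    by apply: eq_bigl => j; rewrite inE.
  rewrite (set_partition_big _ partP)/=; apply: eq_bigr => N NP.
  rewrite (eq_bigr (fun=> #|N|%:R)) => [|j jN]; last by rewrite (def_pblock trivP NP jN).
  by rewrite sumr_const expr2 mulr_natr.
apply: (@le_trans _ _ (\sum_(j < n) (n%:R - #|pblock P j|%:R))).
  by apply: ler_sum => j _; exact: normA_le.
have sqE : n%:R *+ n = n%:R ^+ 2 :> R by rewrite expr2 mulr_natr.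
rewrite sumrB sumr_const card_ord blockE mulrBr mulr1 sqE lerD2l.
by rewrite lerN2 -cardP; have := @sum_sqr_card_partition R _ P partP P0; rewrite card_ord.
Qed.

Theorem theorem4p40 (R : realType) (n r : nat) (hr : (2 <= r)%N) (hn : (r <= n)%N)
    (p : R) (hp1 : 1 <= p) (hp2 : p < 2) (A : 'M[R[i]]_n) (hA : max_norm A <= 1)
    (hpart : rpartite r A) :
  schatten_norm p A <= n%:R `^ (2^-1 + p^-1) * Num.sqrt (1 - r%:R^-1)
  /\ (schatten_norm p A = n%:R `^ (2^-1 + p^-1) * Num.sqrt (1 - r%:R^-1)
      <-> forall i : 'I_n,
            tnth (singular_values A) i = Num.sqrt ((1 - r%:R^-1) * n%:R)).
Proof.
have p0 : 0 < p by exact: lt_le_trans ltr01 hp1.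
have n0 : 0 < n%:R :> R by rewrite ltr0n (leq_trans _ hn)// (leq_trans _ hr).
have c0 : 0 < 1 - r%:R^-1 :> R.
  by rewrite subr_gt0 invf_lt1 ?ltr1n// ltr0n (leq_trans _ hr).
set c : R := 1 - r%:R^-1 in c0 *; pose d : R := Num.sqrt (c * n%:R).
have d0 : 0 < d by rewrite sqrtr_gt0 mulr_gt0.
have boundE : n%:R `^ (2^-1 + p^-1) * Num.sqrt c = (n%:R * d `^ p) `^ p^-1.
  rewrite powRM ?powR_ge0//.
  rewrite -powRrM mulfV ?gt_eqF// powRr1; last exact: ltW.
  rewrite powRD; last by rewrite (gt_eqF n0) implybT.
  rewrite powR12_sqrt//.
  by rewrite /d sqrtrM ?(ltW c0)// [_ * n%:R `^ _]mulrC -mulrA [Num.sqrt _ * _]mulrC.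
have s0 i : 0 <= tnth (singular_values A) i.
  have : tnth (singular_values A) i \in singular_values A by exact: mem_tnth.
  by rewrite mem_sort => /mapP[j _ ->]; exact: sqrtr_ge0.
have le2 : \sum_(i < n) tnth (singular_values A) i ^+ 2 <= #|'I_n|%:R * d ^+ 2.
  rewrite sum_sqr_singular_values card_ord sqr_sqrtr; last by rewrite mulr_ge0// ltW.
  rewrite [c * _]mulrC mulrA -expr2.
  by apply: rpartite_sum_sqr_le => //; exact: leq_trans hr.
have [lep eqp] := sum_powR_le p0 hp2 d0 s0 le2; rewrite card_ord in lep eqp.
have sump0 : 0 <= \sum_(i < n) tnth (singular_values A) i `^ p.
  by apply: sumr_ge0 => i _; exact: powR_ge0.
have bound0 : 0 <= n%:R * d `^ p by rewrite mulr_ge0 ?powR_ge0// ltW.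
rewrite boundE /schatten_norm; split.
  by rewrite ge0_ler_powR ?nnegrE// invr_ge0 ltW.
split=> [|all_d].
  by move/powR_injective; rewrite invr_gt0 !nnegrE => /(_ p0 sump0 bound0) /eqp.
by under eq_bigr do rewrite all_d; rewrite sumr_const card_ord -[RHS]/(_ `^ _) mulr_natl.
Qed.
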